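(* Let $G$ be a graph with $n$ vertices $v_1,\ldots,v_n$, $m$ edges and degree sequence $d_1,\ldots,d_n$, with Laplacian eigenvalues $\mu_1\ge\mu_2\ge\cdots\ge\mu_{n-1}\ge\mu_n=0$. Then $$\left(\frac{\Upsilon(n-1)-(Z_g(G)+2m)^2}{(n-1)(Z_g(G)+2m)}\right)^{\frac12}\ \le\ S_L(G).$$
   Context: Graphs are finite, simple and undirected; $d_i$ is the degree of $v_i$ and $v_s\sim v_i$ means adjacency. The Laplacian matrix is $L(G)=D(G)-A(G)$ ($D(G)$ the diagonal matrix of vertex degrees, $A(G)$ the adjacency matrix), and the Laplacian spread is $S_L(G)=\mu_1-\mu_{n-1}$. The first Zagreb index is $Z_g(G)=\sum_{i=1}^n d_i^2$. For $i\ne j$, $\varkappa_{ij}=\varkappa_{ji}$ is the number of common neighbors of $v_i$ and $v_j$. The quantity $\Upsilon$ is $$\Upsilon=\sum_{i=1}^n(d_i^4+3d_i^3)+Z_g(G)+\sum_{i=1}^n\left(\sum_{s=1,\,s\ne i}^n\varkappa_{is}^2+\sum_{v_s\sim v_i}\Big(2d_i(d_s-\varkappa_{si})+d_s(d_s-2\varkappa_{si})\Big)\right).$$ *)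

(* Defs.v *)
From HB Require Import structures.
From mathcomp Require Export all_boot all_order all_algebra.
From mathcomp Require complex.

Set Implicit Arguments.
Unset Strict Implicit.
Unset Printing Implicit Defensive.

Import Order.TTheory GRing.Theory Num.Theory.
Local Open Scope ring_scope.

Record graph (n : nat) := Graph {
  adj :> rel 'I_n;
  adj_sym : symmetric adj;
  adj_irr : irreflexive adj
}.

Section Invariants.
Variables (n : nat) (G : graph n).

Definition deg (i : 'I_n) : nat := #|[set j | G i j]|.

(* Each undirected edge is counted once, as the pair (i, j) with i < j. *)
Definition num_edges : nat :=
  #|[set p : 'I_n * 'I_n | (p.1 < p.2)%N && G p.1 p.2]|.

Definition zagreb1 : nat := (\sum_i deg i ^ 2)%N.

Definition common_nbrs (i j : 'I_n) : nat := #|[set k | G i k && G j k]|.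

End Invariants.

Section Laplacian.
Variables (R : rcfType) (n : nat) (G : graph n).

Definition adjacency_mx : 'M[R]_n := \matrix_(i, j) (G i j)%:R.

Definition degree_mx : 'M[R]_n := diag_mx (\row_i (deg G i)%:R).

Definition laplacian : 'M[R]_n := degree_mx - adjacency_mx.

(* Computed in R, since d_s - 2 * kappa_si can be negative. *)
Definition Upsilon : R :=
  let d i : R := (deg G i)%:R in
  let kappa i j : R := (common_nbrs G i j)%:R in
  \sum_i (d i ^+ 4 + 3 * d i ^+ 3) + (zagreb1 G)%:R
  + \sum_i (\sum_(s | s != i) kappa i s ^+ 2
            + \sum_(s | G s i) (2 * d i * (d s - kappa s i)
                                + d s * (d s - 2 * kappa s i))).

Lemma laplacian_sym : laplacian^T = laplacian.
Proof.
rewrite /laplacian /degree_mx raddfB /= tr_diag_mx; congr (_ - _).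
by apply/matrixP=> i j; rewrite !mxE adj_sym.
Qed.

End Laplacian.

Section Spectrum.

Lemma char_poly_diag (F : comNzRingType) n (d : 'rV[F]_n) :
  char_poly (diag_mx d) = \prod_i ('X - (d 0 i)%:P).
Proof.
rewrite char_poly_trig ?diag_mx_is_trig //.
by apply: eq_bigr => i _; rewrite mxE eqxx mulr1n.
Qed.

Lemma char_poly_conj (F : fieldType) n (P A : 'M[F]_n) :
  P \in unitmx -> char_poly (invmx P *m A *m P) = char_poly A.
Proof.
move=> Pu; rewrite /char_poly /char_poly_mx.
set p := map_mx polyC P; set q := map_mx polyC (invmx P).
have qp : q *m p = 1%:M by rewrite -map_mxM mulVmx // map_mx1.
have -> : 'X%:M - map_mx polyC (invmx P *m A *m P)
        = q *m ('X%:M - map_mx polyC A) *m p.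
  rewrite !map_mxM mulmxBr mulmxBl; congr (_ - _).
  by rewrite scalar_mxC -mulmxA qp mulmx1.
by rewrite !det_mulmx mulrAC -det_mulmx qp det1 mul1r.
Qed.

Import complex.

Lemma sym_spectrum_exists (R : rcfType) n (A : 'M[R]_n) : A^T = A ->
  exists mu : n.-tuple R,
    sorted >=%R mu && (char_poly A == \prod_(x <- mu) ('X - x%:P)).
Proof.
move=> Asym.
pose f : {rmorphism R -> complex R} := real_complex R.
pose B := map_mx f A.
have Bherm : B \is hermsymmx.
  apply: realsym_hermsym.
    apply/is_hermitianmxP; rewrite expr0 scale1r.
    by apply/matrixP=> i j; rewrite !mxE -[in LHS]Asym mxE.
  apply/mxOverP=> i j; rewrite mxE; apply/complex_realP.
  by exists (A i j).
have /orthomx_spectralP Beq := hermitian_normalmx Bherm.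
have dreal := hermitian_spectral_diag_real Bherm.
set d := spectral_diag B in Beq dreal.
pose l := [seq complex.Re (d 0 i) | i <- enum 'I_n].
have sl : size (sort >=%R l) == n by rewrite size_sort size_map size_enum_ord.
exists (Tuple sl); apply/andP; split=> /=.
  by apply: sort_sorted => x y; rewrite /= le_total.
apply/eqP; rewrite (perm_big l) ?perm_sort //=.
apply: (map_poly_inj f); rewrite map_char_poly -/B Beq.
rewrite char_poly_conj ?spectral_unit // char_poly_diag big_map big_enum /=.
rewrite rmorph_prod; apply: eq_bigr => i _.
rewrite rmorphB /= map_polyX map_polyC /=.
by rewrite [real_complex_def _ _]RRe_real // (mxOverP dreal).
Qed.

End Spectrum.

Section Spread.
Variables (R : rcfType) (n : nat) (G : graph n).

(* The n roots of the characteristic polynomial, with multiplicity and in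
   nonincreasing order; these two properties determine the tuple. *)
Definition laplacian_eigenvalues : n.-tuple R :=
  xchoose (sym_spectrum_exists (laplacian_sym R G)).

Lemma laplacian_eigenvaluesP :
  sorted >=%R laplacian_eigenvalues
  /\ char_poly (laplacian R G)
     = \prod_(x <- laplacian_eigenvalues) ('X - x%:P).
Proof.
by case/andP: (xchooseP (sym_spectrum_exists (laplacian_sym R G))) => ? /eqP.
Qed.

(* mu_1 and mu_(n-1) have the 0-based positions 0 and n - 2; this is
   meaningful only for n >= 2. *)
Definition laplacian_spread : R :=
  laplacian_eigenvalues`_0 - laplacian_eigenvalues`_(n - 2).

End Spread.

(* Main.v *)
Require Import Defs.
From mathcomp Require Import ring lra.
From mathcomp Require complex.

Import Order.TTheory GRing.Theory Num.Theory.

Local Open Scope ring_scope.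

(** The radicand depends only on the Laplacian spectrum: [Z_g + 2m] is the
    trace of [L^2] and [Upsilon] is the trace of [L^4]
    ([trace_laplacian_sqr], [trace_laplacian_pow4]). The first holds because
    the diagonal entries of [L^2] are [d_i^2 + d_i]; the second because [L^2]
    is symmetric, so the trace of its square is the sum of the squares of its
    entries, and its off-diagonal entries are
    [kappa_ij - a_ij (d_i + d_j)] ([laplacian_sqrE]). By the spectral theorem
    ([trace_exp_sym_mx]) these traces are the power sums [T2] and [T4] of the
    eigenvalues.

    [L] is positive semidefinite and singular, so the smallest eigenvalue is 0
    and contributes nothing to [T2] and [T4]. The other [N = n - 1] eigenvalues
    lie in an interval [[b, a]] with [b >= 0] and [a - b] the spread. Summing
    [(x^2 - b^2) (a^2 - x^2) >= 0] over them gives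
    [T4 <= (a^2 + b^2) T2 - N a^2 b^2], hence
    [N T4 - T2^2 <= N T2 (a - b)^2 - (T2 - N a b)^2]
    ([sum_sqr_pow4_range]). Dividing by [N T2] and taking square roots yields
    the bound; if [T2 = 0], the quotient is 0. *)

Lemma trace_conj_diag_exp (F : comUnitRingType) n (P : 'M[F]_n) (d : 'rV_n) k :
  P \in unitmx ->
  \tr ((invmx P *m diag_mx d *m P) ^+ k) = \sum_i d 0 i ^+ k.
Proof.
move=> Pu; have conjM (D E : 'M_n) :
    invmx P *m D *m P *m (invmx P *m E *m P) = invmx P *m (D *m E) *m P.
  by rewrite !mulmxA mulmxK.
have -> : (invmx P *m diag_mx d *m P) ^+ k
        = invmx P *m diag_mx (\row_i d 0 i ^+ k) *m P.
  elim: k => [|k IHk].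
    rewrite expr0 (_ : diag_mx _ = 1%:M) ?mulmx1 ?mulVmx //.
    by apply/matrixP=> i j; rewrite !mxE expr0.
  rewrite exprSr IHk -mulmxE conjM mulmx_diag.
  congr (_ *m diag_mx _ *m _).
  by apply/rowP=> i; rewrite !mxE exprSr.
rewrite mxtrace_mulC mulmxA mulmxV // mul1mx mxtrace_diag.
by apply: eq_bigr => i _; rewrite mxE.
Qed.

Section PowerSums.
Import complex.

(** The matrix is diagonalised over the complex extension of [R]; unique
    factorisation of the characteristic polynomial identifies the diagonal with
    [s] up to order, and the resulting identity descends to [R]. *)
Lemma trace_exp_sym_mx (R : rcfType) (n : nat) (A : 'M[R]_n) (s : seq R) k :
  A^T = A -> char_poly A = \prod_(x <- s) ('X - x%:P) ->
  \tr (A ^+ k) = \sum_(x <- s) x ^+ k.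
Proof.
move=> Asym charA.
pose f : {rmorphism R -> complex R} := real_complex R.
pose B := map_mx f A.
have Bherm : B \is hermsymmx.
  apply: realsym_hermsym.
    apply/is_hermitianmxP; rewrite expr0 scale1r.
    by apply/matrixP=> i j; rewrite !mxE -[in LHS]Asym mxE.
  apply/mxOverP=> i j; rewrite mxE; apply/complex_realP.
  by exists (A i j).
have [P [d Pu Beq]] : exists P, exists2 d : 'rV_n,
    P \in unitmx & B = invmx P *m diag_mx d *m P.
  exists (spectralmx B), (spectral_diag B); first exact: spectral_unit.
  exact/orthomx_spectralP/hermitian_normalmx.
have perm_d : perm_eq (map f s) [seq d 0 i | i <- enum 'I_n].
  apply: prod_XsubC_eq; rewrite big_map [RHS]big_map big_enum /= -char_poly_diag.
  rewrite -(char_poly_conj (diag_mx d) Pu) -Beq -map_char_poly charA rmorph_prod.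
  by apply: eq_bigr => x _; rewrite rmorphB /= map_polyX map_polyC.
apply: (fmorph_inj f); rewrite -trace_map_mx rmorphXn /= -/B Beq.
rewrite trace_conj_diag_exp // rmorph_sum /=.
under [RHS]eq_bigr do rewrite rmorphXn.
by rewrite -(big_map f predT (fun x => x ^+ k)) (perm_big _ perm_d) big_map big_enum.
Qed.

End PowerSums.

Lemma trace_sqr_sym_mx (R : pzSemiRingType) n (A : 'M[R]_n) :
  A^T = A -> \tr (A *m A) = \sum_i \sum_j A i j ^+ 2.
Proof.
move=> Asym; apply: eq_bigr => i _; rewrite mxE; apply: eq_bigr => j _.
by rewrite -{2}Asym mxE expr2.
Qed.

Section LaplacianMatrix.
Variables (R : rcfType) (n : nat) (G : graph n).
Let L := laplacian R G.
Let a i j : R := (G i j)%:R.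
Let d i : R := (deg G i)%:R.
Let kappa i j : R := (common_nbrs G i j)%:R.

Let aC i j : a i j = a j i.
Proof. by rewrite /a adj_sym. Qed.

Lemma sum_adj i : \sum_j a i j = d i.
Proof.
rewrite /a /d -natr_sum /deg -sum1_card [in RHS]big_mkcond; congr _%:R.
by apply: eq_bigr => j _; rewrite inE; case: (G i j).
Qed.

Lemma sum_adj_nbrs (F : 'I_n -> R) i : \sum_j a i j * F j = \sum_(j | G j i) F j.
Proof.
rewrite [RHS]big_mkcond; apply: eq_bigr => j _.
by rewrite aC /a; case: (G j i); rewrite ?mul1r ?mul0r.
Qed.

Lemma sum_adj_adj i j : \sum_k a i k * a k j = kappa i j.
Proof.
rewrite /kappa /common_nbrs -sum1_card [in RHS]big_mkcond natr_sum.
apply: eq_bigr => k _; rewrite inE (aC k) /a -natrM mulnb.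
by case: (_ && _).
Qed.

Lemma common_nbrs_diag i : common_nbrs G i i = deg G i.
Proof. by rewrite /common_nbrs /deg; apply: eq_card => j; rewrite !inE andbb. Qed.

Lemma laplacianE i j : L i j = d i *+ (i == j) - a i j.
Proof. by rewrite !mxE. Qed.

(** Expand [(D - A)^2]: the entries of [A^2] count common neighbours, which on
    the diagonal are all the neighbours. *)
Lemma laplacian_sqrE i j :
  (L *m L) i j = (if i == j then d i ^+ 2 + d i
                  else kappa i j - a i j * (d i + d j)).
Proof.
rewrite mulmxBl !mulmxBr (mul_mx_diag (degree_mx R G)).
rewrite (mul_mx_diag (adjacency_mx R G)) mul_diag_mx !mxE.
under eq_bigr do rewrite !mxE.
rewrite sum_adj_adj -/(a i j) -/(d i) -/(d j).
case: eqVneq => [<-|_]; last by rewrite !mulr0n; ring.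
rewrite /kappa common_nbrs_diag -/(d i) /a adj_irr mulr0n !mulr1n; ring.
Qed.

(** This difference form shows both that constant vectors lie in the kernel
    and that the quadratic form of the Laplacian is nonnegative. *)
Lemma mul_row_laplacian (v : 'rV_n) j :
  (v *m L) 0 j = \sum_i a i j * (v 0 j - v 0 i).
Proof.
rewrite mxE; under eq_bigr do rewrite laplacianE mulrBr.
under [RHS]eq_bigr do rewrite mulrBr.
rewrite !sumrB -mulr_suml; under [in RHS]eq_bigr do rewrite aC.
rewrite sum_adj (bigD1 j) //= big1 ?addr0 => [|i /negPf->]; last by rewrite mulr0.
rewrite eqxx mulrC; congr (_ - _).
by apply: eq_bigr => i _; rewrite aC mulrC.
Qed.

Lemma laplacian_eigenvalue0 : (0 < n)%N -> eigenvalue L 0.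
Proof.
move=> n_gt0; apply/eigenvalueP; exists (const_mx 1).
  rewrite scale0r; apply/rowP=> j; rewrite mul_row_laplacian [RHS]mxE big1 // => i _.
  by rewrite !mxE subrr mulr0.
apply/eqP=> /rowP/(_ (Ordinal n_gt0)); rewrite !mxE; apply/eqP; exact: oner_neq0.
Qed.

(** For an eigenvector [v], the number [x * |v|^2] equals
    [1/2 \sum_(i, j) a_ij (v_j - v_i)^2]. *)
Lemma laplacian_eigenvalue_ge0 x : eigenvalue L x -> 0 <= x.
Proof.
case/eigenvalueP=> v vL v_neq0.
pose q := \sum_i \sum_j a i j * (v 0 j - v 0 i) * v 0 j.
have q_eq : x * \sum_j v 0 j ^+ 2 = q.
  rewrite /q exchange_big mulr_sumr; apply: eq_bigr => j _.
  by rewrite -mulr_suml -mul_row_laplacian vL mxE expr2 mulrA.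
(* Exchanging the two endpoints of each edge; adding this form of [q] to the
   original one completes the square. *)
have q_swap : q = \sum_i \sum_j - (a i j * (v 0 j - v 0 i) * v 0 i).
  rewrite /q exchange_big; apply: eq_bigr => i _; apply: eq_bigr => j _.
  by rewrite aC; ring.
have q_ge0 : 0 <= q.
  suff : 0 <= q + q by lra.
  rewrite {2}q_swap -big_split sumr_ge0 // => i _.
  rewrite -big_split sumr_ge0 // => j _ /=.
  rewrite (_ : _ + _ = a i j * (v 0 j - v 0 i) ^+ 2); last by ring.
  by rewrite mulr_ge0 ?sqr_ge0 ?ler0n.
rewrite -(pmulr_lge0 (x := \sum_j v 0 j ^+ 2)) ?q_eq //.
have /rV0Pn[i vi_neq0] := v_neq0.
rewrite (bigD1 i) //= ltr_pwDl ?sumr_ge0 // => [|j _]; last exact: sqr_ge0.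
by rewrite exprn_even_gt0.
Qed.

(** Each edge [{i, j}] is counted at both ends; splitting the sum of [a i j]
    at [i < j] and [j < i] gives two copies of the edge count. *)
Lemma sum_deg : \sum_i d i = 2 * (num_edges G)%:R.
Proof.
under eq_bigr do rewrite -sum_adj.
have -> : (num_edges G)%:R
    = \sum_(i : 'I_n) \sum_(j : 'I_n) if (i < j)%N then a i j else 0 :> R.
  rewrite pair_big /= /num_edges -sum1_card natr_sum big_mkcond.
  by apply: eq_bigr => -[i j] _; rewrite inE /a /=; case: (_ < _)%N; case: (G i j).
rewrite mulr_natl mulr2n [X in _ = _ + X]exchange_big -big_split.
apply: eq_bigr => i _; rewrite -big_split; apply: eq_bigr => j _ /=.
by case: ltngtP => [_|_|/val_inj->]; rewrite ?addr0 ?add0r // /a adj_irr.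
Qed.

Lemma trace_laplacian_sqr :
  \tr (L ^+ 2) = (zagreb1 G)%:R + 2 * (num_edges G)%:R.
Proof.
rewrite -sum_deg /zagreb1 natr_sum -big_split; apply: eq_bigr => i _.
by rewrite expr2 -mulmxE laplacian_sqrE eqxx natrX.
Qed.

(** Row by row, the sum of the squared entries of [L^2] is compared with
    [Upsilon]: the terms [a_is d_i^2] of the squares of [a_is (d_i + d_s)] sum
    to [d_i^3], the third copy of the cubic term, since the diagonal entry
    [(d_i^2 + d_i)^2] provides only two. *)
Lemma trace_laplacian_pow4 : \tr (L ^+ 4) = Upsilon R G.
Proof.
rewrite (_ : 4 = 2 * 2)%N // exprM expr2 -mulmxE trace_sqr_sym_mx; last first.
  by rewrite expr2 -mulmxE trmx_mul !laplacian_sym.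
rewrite expr2 -mulmxE /Upsilon /zagreb1 natr_sum -!big_split.
apply: eq_bigr => i _ /=; rewrite natrX -/(d i).
rewrite -(sum_adj_nbrs (fun s => 2 * d i * (d s - kappa s i)
                                 + d s * (d s - 2 * kappa s i))).
rewrite (bigD1 i) //= laplacian_sqrE eqxx.
rewrite [\sum_j a i j * _](bigD1 i) //= {1}/a adj_irr mul0r add0r.
have dE : d i = \sum_(j | j != i) a i j.
  by rewrite -sum_adj (bigD1 i) //= /a adj_irr add0r.
rewrite -big_split /=.
have -> : \sum_(s | s != i) (L *m L) i s ^+ 2
  = \sum_(s | s != i) (kappa i s ^+ 2 + a i s *
      (2 * d i * (d s - kappa s i) + d s * (d s - 2 * kappa s i))
      + a i s * d i ^+ 2).
  apply: eq_bigr => s s_neq; rewrite laplacian_sqrE eq_sym (negPf s_neq).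
  have -> : kappa s i = kappa i s.
    by rewrite -!sum_adj_adj; apply: eq_bigr => k _; rewrite mulrC aC (aC k).
  by rewrite /a; case: (G i s); rewrite ?mulr0n ?mulr1n; ring.
rewrite big_split /= -mulr_suml -dE; ring.
Qed.

End LaplacianMatrix.

(** A variance bound for the squares: the pointwise inequality
    [(x^2 - b^2) (a^2 - x^2) >= 0] is summed, and the remaining slack is the
    square of [T2 - N a b]. *)
Lemma sum_sqr_pow4_range (R : realDomainType) (I : Type) (r : seq I)
    (x : I -> R) (a b : R) :
  0 <= b -> all (fun i => b <= x i <= a) r ->
  (\sum_(i <- r) x i ^+ 4) * (size r)%:R - (\sum_(i <- r) x i ^+ 2) ^+ 2
  <= (a - b) ^+ 2 * ((size r)%:R * \sum_(i <- r) x i ^+ 2).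
Proof.
move=> b_ge0 x_range; set N := (size r)%:R.
set T2 := \sum_(i <- r) _ ^+ 2; set T4 := \sum_(i <- r) _ ^+ 4.
have T4_le : T4 <= (a ^+ 2 + b ^+ 2) * T2 - N * (a * b) ^+ 2.
  rewrite /T4 /T2 /N; elim: r x_range {N T2 T4} => [|i r IHr] /=.
    by rewrite !big_nil mulr0 mul0r subr0.
  case/andP=> /andP[bx xa] /IHr IH; rewrite !big_cons -natr1.
  have : 0 <= (x i ^+ 2 - b ^+ 2) * (a ^+ 2 - x i ^+ 2).
    by rewrite mulr_ge0 // subr_ge0 lerXn2r ?nnegrE //; lra.
  lra.
have := sqr_ge0 (T2 - N * a * b).
have : T4 * N <= ((a ^+ 2 + b ^+ 2) * T2 - N * (a * b) ^+ 2) * N.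
  by rewrite ler_wpM2r ?ler0n.
lra.
Qed.

Theorem theorem21 (R : rcfType) (n : nat) (G : graph n) (hn : (2 <= n)%N) :
  Num.sqrt ((Upsilon R G * (n%:R - 1)
             - ((zagreb1 G)%:R + 2 * (num_edges G)%:R) ^+ 2)
            / ((n%:R - 1) * ((zagreb1 G)%:R + 2 * (num_edges G)%:R)))
  <= laplacian_spread R G.
Proof.
have [mu_sorted charL] := laplacian_eigenvaluesP R G.
rewrite -trace_laplacian_sqr -trace_laplacian_pow4 /laplacian_spread.
rewrite !(trace_exp_sym_mx _ _ _ _ _ (laplacian_sym R G) charL).
have size_mu : size (laplacian_eigenvalues R G) = n by rewrite size_tuple.
move: (tval _) mu_sorted charL size_mu => mu mu_sorted charL size_mu.
have mu_eig x : (x \in mu) = eigenvalue (laplacian R G) x.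
  by rewrite eigenvalue_root_char charL root_prod_XsubC.
have mu_le i j : (i <= j < n)%N -> mu`_j <= mu`_i.
  case/andP=> ij jn.
  apply: (sorted_leq_nth (rev_trans le_trans) (fun=> le_refl _) 0 mu_sorted);
    by rewrite ?inE ?size_mu // (leq_ltn_trans ij).
have mu_ge0 i : (i < n)%N -> 0 <= mu`_i.
  by move=> i_lt; rewrite (@laplacian_eigenvalue_ge0 _ _ G) // -mu_eig mem_nth ?size_mu.
case: n hn G mu_eig size_mu mu_le mu_ge0 {charL} => [|[|m]] // _ G.
move=> mu_eig size_mu mu_le mu_ge0.
have mu_last : mu`_m.+1 = 0.
  have : 0 \in mu by rewrite mu_eig laplacian_eigenvalue0.
  case/(nthP 0)=> i; rewrite size_mu => i_lt mu_i.
  by apply/eqP; rewrite eq_le mu_ge0 // andbT -[leRHS]mu_i mu_le // -ltnS i_lt /=.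
(* The exponent is a successor so that the eigenvalue 0 drops out. *)
have drop_last k :
    \sum_(x <- mu) x ^+ k.+1 = \sum_(i <- iota 0 m.+1) mu`_i ^+ k.+1.
  by rewrite (big_nth 0) size_mu big_nat_recr //= mu_last expr0n addr0
    /index_iota subn0.
have spread_ge0 : 0 <= mu`_0 - mu`_m.
  by rewrite subr_ge0 mu_le //= ltnW.
have -> : (m.+2 - 2 = m)%N by rewrite !subSS subn0.
rewrite !drop_last -(natr1 m.+1) addrK.
set T2 := \sum_(i <- _) _ ^+ 2.
rewrite -[leRHS]ger0_norm // -sqrtr_sqr ler_wsqrtr //.
have : 0 <= m.+1%:R * T2.
  by rewrite mulr_ge0 ?ler0n // sumr_ge0 // => i _; apply: sqr_ge0.
(* A graph without edges has [T2 = 0]; the quotient is then [_ / 0 = 0]. *)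
rewrite le_eqVlt => /predU1P[<-|den_gt0]; first by rewrite invr0 mulr0 sqr_ge0.
rewrite ler_pdivrMr // -[X in X%:R](size_iota 0 m.+1).
apply: sum_sqr_pow4_range; first exact: mu_ge0.
apply/allP=> i; rewrite mem_iota add0n ltnS => /andP[_ i_le].
by apply/andP; split; apply: mu_le; rewrite ?i_le /= ltnS leqW.
Qed.
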